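(* Let $\Omega$ be a complete separable metric space and $\hat{\mathbb{E}}$ a regular sublinear expectation on $\mathcal{H}=C_{b.Lip}(\Omega)$ (extended to $L^1(\Omega)$). Let $d\ge1$, $n>1$, and let $\{X_i\}_{i=1}^n$ be an independent sequence of random vectors in $L^2(\Omega;\mathbb{R}^d)$ under $\hat{\mathbb{E}}$. For $i\le n$ set $$\Theta_i=\{\theta\in\mathbb{R}^d:\langle\theta,p\rangle\le\hat{\mathbb{E}}[\langle p,X_i\rangle]\text{ for all }p\in\mathbb{R}^d\},$$ and let $$\Theta=\Big\{\frac1n\sum_{i=1}^n\theta_i:\theta_i\in\Theta_i\text{ for }i\le n\Big\},\qquad \rho_\Theta(x)=\inf\{|x-\theta|:\theta\in\Theta\}\ \ (x\in\mathbb{R}^d),$$ $$\bar\sigma_n^2=\sup_{i\le n}\ \inf_{\theta_i\in\Theta_i}\hat{\mathbb{E}}[|X_i-\theta_i|^2].$$ Then $$\hat{\mathbb{E}}\left[\rho_\Theta^2\left(\frac1n\sum_{i=1}^nX_i\right)\right]\le\frac{\bar\sigma_n^2}{n}.$$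
   Context: Setting. $\Omega$ is a complete separable metric space with Borel $\sigma$-field $\mathcal{B}(\Omega)$; $\mathcal{H}=C_{b.Lip}(\Omega)$ is the space of bounded Lipschitz real functions on $\Omega$. A functional $\hat{\mathbb{E}}:\mathcal{H}\to\mathbb{R}$ is a regular sublinear expectation if for $X,Y,X_n\in\mathcal{H}$: (i) $X\ge Y$ implies $\hat{\mathbb{E}}[X]\ge\hat{\mathbb{E}}[Y]$; (ii) $\hat{\mathbb{E}}[c]=c$ for $c\in\mathbb{R}$; (iii) $\hat{\mathbb{E}}[X+Y]\le\hat{\mathbb{E}}[X]+\hat{\mathbb{E}}[Y]$; (iv) $\hat{\mathbb{E}}[\lambda X]=\lambda\hat{\mathbb{E}}[X]$ for $\lambda\ge0$; (v) $X_n\downarrow0$ implies $\hat{\mathbb{E}}[X_n]\downarrow0$. It is a known fact (representation theorem) that there exists a convex and weakly compact set $\mathcal{P}$ of probability measures on $(\Omega,\mathcal{B}(\Omega))$ with $\hat{\mathbb{E}}[X]=\sup_{P\in\mathcal{P}}E_P[X]$ for $X\in\mathcal{H}$. For $p\ge1$, $L^p(\Omega)$ is the completion of $\mathcal{H}$ under the norm $\|X\|_p=(\hat{\mathbb{E}}[|X|^p])^{1/p}$; $L^p(\Omega)\subset L^1(\Omega)$, $\hat{\mathbb{E}}$ extends continuously to $L^1(\Omega)$, and the representation $\hat{\mathbb{E}}[X]=\sup_{P\in\mathcal{P}}E_P[X]$ still holds for $X\in L^1(\Omega)$. As usual, elements of $L^p(\Omega)$ are regarded as random variables on $\Omega$,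 identified when they agree outside a set that is null under every $P\in\mathcal{P}$. $L^p(\Omega;\mathbb{R}^d)$ is the set of random vectors $X=(X^1,\ldots,X^d)^T$ with every $X^j\in L^p(\Omega)$. Independence. $C_{b.Lip}(\mathbb{R}^m)$ is the space of bounded Lipschitz functions on $\mathbb{R}^m$. $Y\in L^1(\Omega;\mathbb{R}^{d_2})$ is independent of $X\in L^1(\Omega;\mathbb{R}^{d_1})$ if for each $\psi\in C_{b.Lip}(\mathbb{R}^{d_1+d_2})$, $\hat{\mathbb{E}}[\psi(X,Y)]=\hat{\mathbb{E}}\big[\hat{\mathbb{E}}[\psi(x,Y)]_{x=X}\big]$. A sequence $\{X_i\}_{i=1}^n\subset L^1(\Omega;\mathbb{R}^d)$, $n>1$, is independent if $X_{i+1}$ is independent of $(X_1,\ldots,X_i)$ for $1\le i\le n-1$ (this notion is not symmetric). $\langle\cdot,\cdot\rangle$ and $|\cdot|$ are the Euclidean inner product and norm. *)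

(* Defs.v *)
From HB Require Import structures.
From mathcomp Require Import all_boot all_order all_algebra.
From mathcomp Require Import all_classical all_reals all_analysis.

Set Implicit Arguments.
Unset Strict Implicit.
Unset Printing Implicit Defensive.

Import Order.TTheory GRing.Theory Num.Theory.
Import numFieldNormedType.Exports.

Local Open Scope classical_set_scope.
Local Open Scope ring_scope.

(* The pointedness that comes with the library's complete spaces is harmless:
   on an empty space no functional satisfies E (cst c) = c for every c. *)
#[short(type="completeMetricType")]
HB.structure Definition CompleteMetric (R : numDomainType) :=
  {T of CompletePseudoMetric R T & Metric R T}.

Definition separable (T : topologicalType) : Prop :=
  exists2 D : set T, countable D & dense D.

Notation borelType T := (g_sigma_algebraType (@open T)).

Section euclidean.
Context {R : realType} {m : nat}.

Definition dotp (x y : 'rV[R]_m) : R := \sum_(j < m) x 0 j * y 0 j.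

(* The library norm on 'rV[R]_m is the sup norm. *)
Definition enorm (x : 'rV[R]_m) : R := Num.sqrt (dotp x x).

Definition edist (x y : 'rV[R]_m) : R := enorm (x - y).

Definition dist_to (A : set 'rV[R]_m) (x : 'rV[R]_m) : R :=
  inf [set enorm (x - a) | a in A].

End euclidean.

Definition bounded_lipschitz {R : realType} {T : Type} (dist : T -> T -> R)
    (f : T -> R) : Prop :=
  (exists M, forall x, `|f x| <= M) /\
  (exists L, forall x y, `|f x - f y| <= L * dist x y).

Definition decreases_to {R : realType} (u : R^nat) (l : R) : Prop :=
  nonincreasing_seq u /\ u @ \oo --> l.

Section sublinear_expectation.
Context {R : realType} {Omega : completeMetricType R}.

Definition CbLip : set (Omega -> R) := bounded_lipschitz (@mdist R Omega).

(* E is a total function of which only the values on CbLip are relevant. *)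
Record regular_sublinear_expectation (E : (Omega -> R) -> R) : Prop := {
  sle_monotone : forall X Y, CbLip X -> CbLip Y ->
    (forall w, Y w <= X w) -> E Y <= E X ;
  sle_cst : forall c : R, E (cst c) = c ;
  sle_subadditive : forall X Y, CbLip X -> CbLip Y ->
    E (X \+ Y) <= E X + E Y ;
  sle_homogeneous : forall (l : R) X, CbLip X -> 0 <= l ->
    E (fun w => l * X w) = l * E X ;
  sle_regular : forall X : nat -> Omega -> R, (forall n, CbLip (X n)) ->
    (forall w, decreases_to (fun n => X n w) 0) ->
    decreases_to (fun n => E (X n)) 0 }.

Local Notation Prob := (probability (borelType Omega) R).

Definition convex_probabilities (PP : set Prob) : Prop :=
  forall (P Q : Prob) (t : R), PP P -> PP Q -> 0 <= t <= 1 ->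
    exists2 S : Prob, PP S &
      forall A : set (borelType Omega), measurable A ->
        S A = (t%:E * P A + (1 - t)%:E * Q A)%E.

Definition Cb : set (Omega -> R) :=
  [set f | continuous f /\ exists M, forall w, `|f w| <= M].

Definition integrals (P : Prob) : {ptws Cb -> R} :=
  fun f => fine ('E_P[(\val f : borelType Omega -> R)])%E.

(* The topology of weak convergence is the coarsest one that makes
   P |-> 'E_P[f] continuous for every bounded continuous f. *)
Definition weakly_compact (PP : set Prob) : Prop :=
  @compact (initial_topology integrals) PP.

Definition upper_expectation (PP : set Prob) (X : Omega -> R) : \bar R :=
  ereal_sup [set ('E_P[(X : borelType Omega -> R)])%E | P in PP].

Record represents (PP : set Prob) (E : (Omega -> R) -> R) : Prop := {
  represents_convex : convex_probabilities PP ;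
  represents_compact : weakly_compact PP ;
  represents_sup : forall X, CbLip X -> (E X)%:E = upper_expectation PP X }.

Definition upper_norm (PP : set Prob) (p : R) (X : Omega -> R) : \bar R :=
  poweR (upper_expectation PP (fun w => `|X w| `^ p)) p^-1.

Definition Lp_approx (PP : set Prob) (p : R) (u : nat -> Omega -> R)
    (X : Omega -> R) : Prop :=
  (forall n, CbLip (u n)) /\
  (upper_norm PP p (u n \- X) @[n --> \oo] --> 0%E).

(* The measurable functions with finite upper_norm are complete, so the
   completion of CbLip is its closure there; two random variables represent the
   same element exactly when they agree outside a set that is null under every
   P in PP. *)
Definition Lp (PP : set Prob) (p : R) : set (Omega -> R) :=
  [set X | measurable_fun [set: borelType Omega] (X : borelType Omega -> R) /\
           exists u, Lp_approx PP p u X].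

Definition Lp_vec (PP : set Prob) (p : R) {m : nat} :
    set (Omega -> 'rV[R]_m) :=
  [set X | forall j, Lp PP p (fun w => X w 0 j)].

(* The continuous extension of E to Lp PP 1: the common limit of E (u n) over
   the sequences u of CbLip that tend to X. *)
Definition sle_ext (PP : set Prob) (E : (Omega -> R) -> R) (X : Omega -> R) : R :=
  xget 0 [set l | exists2 u, Lp_approx PP 1 u X & E (u n) @[n --> \oo] --> l].

Definition independent (PP : set Prob) (E : (Omega -> R) -> R) {d1 d2 : nat}
    (Y : Omega -> 'rV[R]_d2) (X : Omega -> 'rV[R]_d1) : Prop :=
  forall psi : 'rV[R]_(d1 + d2) -> R, bounded_lipschitz edist psi ->
    sle_ext PP E (fun w => psi (row_mx (X w) (Y w))) =
    sle_ext PP E (fun w =>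
      (fun x => sle_ext PP E (fun w' => psi (row_mx x (Y w')))) (X w)).

Definition past {d n : nat} (X : 'I_n -> Omega -> 'rV[R]_d) (i : 'I_n)
    (w : Omega) : 'rV[R]_(i * d) :=
  mxvec (\matrix_(k < i) X (widen_ord (ltnW (ltn_ord i)) k) w).

(* Indices start at 0, so that X i has i predecessors. *)
Definition independent_seq (PP : set Prob) (E : (Omega -> R) -> R) {d n : nat}
    (X : 'I_n -> Omega -> 'rV[R]_d) : Prop :=
  forall i : 'I_n, (0 < i)%N -> independent PP E (X i) (past X i).

Definition mean_set (PP : set Prob) (E : (Omega -> R) -> R) {d : nat}
    (X : Omega -> 'rV[R]_d) : set 'rV[R]_d :=
  [set t | forall p, dotp t p <= sle_ext PP E (fun w => dotp p (X w))].

Definition average_set (PP : set Prob) (E : (Omega -> R) -> R) {d n : nat}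
    (X : 'I_n -> Omega -> 'rV[R]_d) : set 'rV[R]_d :=
  [set n%:R^-1 *: \sum_(i < n) t i | t in
    [set t : 'I_n -> 'rV[R]_d | forall i, mean_set PP E (X i) (t i)]].

Definition max_variance (PP : set Prob) (E : (Omega -> R) -> R) {d n : nat}
    (X : 'I_n -> Omega -> 'rV[R]_d) : R :=
  sup [set inf [set sle_ext PP E (fun w => enorm (X i w - t) ^+ 2)
               | t in mean_set PP E (X i)]
      | i in [set: 'I_n]].

End sublinear_expectation.

(* Main.v *)
Require Import Defs.
From HB Require Import structures.
From mathcomp Require Import all_boot all_order all_algebra.
From mathcomp Require Import all_classical all_reals all_analysis.
From mathcomp Require Import measurable_realfun.
From mathcomp Require Import ring lra.

Import Order.TTheory GRing.Theory Num.Theory.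
Import numFieldNormedType.Exports.

Set Implicit Arguments.
Unset Strict Implicit.
Unset Printing Implicit Defensive.

Local Open Scope classical_set_scope.
Local Open Scope ring_scope.

Local Notation edist := Defs.edist.

(** The proof is a backward recursion over the sequence, in which the best
    centre is chosen afresh for every law.

    Put c = 1/n, S_k = c (X_1 + ... + X_k), and let A_k be the set of all
    c (t_1 + ... + t_k) with t_i in Theta_i, so that A_n = Theta.  Fix a point
    s, a point a of A_k, a point t of Theta_(k+1) and one law P in PP.  The mean
    th of X_(k+1) under P lies in Theta_(k+1), because a linear functional of th
    is the P-mean of that functional of X_(k+1), and E dominates every P-mean.
    Hence a + c th belongs to A_(k+1), and since X_(k+1) - th is P-centred, the
    cross terms vanish and
      E_P dist(A_(k+1), s + c X_(k+1))^2 <= |s - a|^2 + c^2 E_P|X_(k+1) - th|^2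
                                         <= |s - a|^2 + c^2 E_P|X_(k+1) - t|^2.
    Taking the supremum over P and the infima over a and t gives
      E dist(A_(k+1), s + c X_(k+1))^2 <= dist(A_k, s)^2 + c^2 v_(k+1),
    where v_i is the infimum over t in Theta_i of E|X_i - t|^2; this is
    [sle_ext_trunc_sqr_dist_le].  The centre th may depend on P because it has
    disappeared from the bound.  Independence replaces s by S_k
    ([partial_sum_step_le]); induction from A_0 = {0} and S_0 = 0 bounds the
    quantity of the theorem by c^2 (v_1 + ... + v_n), which is at most
    c^2 n times the maximal variance, that is, the maximal variance over n.

    Independence speaks of bounded Lipschitz test functions only, so the
    recursion is run for the truncation min(M, dist(A, x))^2; it survives the
    truncation with the same constants, and M goes to infinity at the end
    ([sle_ext_sqr_le_of_trunc]).

    The other half of the work is to make sure that E, extended to L^1, is the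
    supremum of the P-means at every random variable that occurs ([sle_extE]).
    All of them are Lipschitz functions of square integrable vectors, or squares
    of such functions: [approximable_lipschitz_comp] and [approximable_sqr] show
    that these are limits of bounded Lipschitz functions on Omega. *)

(** * Euclidean geometry of row vectors *)

Lemma inf_nonneg {R : realType} (A : set R) :
  (forall x, A x -> 0 <= x) -> 0 <= inf A.
Proof.
have [->|/set0P A0] := eqVneq A set0; first by rewrite inf0.
exact: lb_le_inf.
Qed.

Section euclidean_geometry.
Context {R : realType} {m : nat}.
Implicit Types (x y z : 'rV[R]_m) (c : R) (A : set 'rV[R]_m).

Lemma dotpC x y : dotp x y = dotp y x.
Proof. by apply: eq_bigr => j _; rewrite mulrC. Qed.

Lemma dotpDl x y z : dotp (x + y) z = dotp x z + dotp y z.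
Proof. by rewrite -big_split; apply: eq_bigr => j _; rewrite mxE mulrDl. Qed.

Lemma dotpZl c x y : dotp (c *: x) y = c * dotp x y.
Proof. by rewrite mulr_sumr; apply: eq_bigr => j _; rewrite mxE mulrA. Qed.

Lemma dotpNl x y : dotp (- x) y = - dotp x y.
Proof. by rewrite -scaleN1r dotpZl mulN1r. Qed.

Lemma dotpDr x y z : dotp x (y + z) = dotp x y + dotp x z.
Proof. by rewrite dotpC dotpDl !(dotpC x). Qed.

Lemma dotpZr c x y : dotp x (c *: y) = c * dotp x y.
Proof. by rewrite dotpC dotpZl dotpC. Qed.

Lemma dotpNr x y : dotp x (- y) = - dotp x y.
Proof. by rewrite dotpC dotpNl dotpC. Qed.

Lemma dotp_ge0 x : 0 <= dotp x x.
Proof. by apply: sumr_ge0 => j _; rewrite -expr2 sqr_ge0. Qed.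

Lemma sqr_enorm x : enorm x ^+ 2 = dotp x x.
Proof. by rewrite sqr_sqrtr ?dotp_ge0. Qed.

Lemma enorm_ge0 x : 0 <= enorm x.
Proof. exact: sqrtr_ge0. Qed.

Lemma enorm0 : enorm (0 : 'rV[R]_m) = 0.
Proof. by rewrite /enorm /dotp big1 ?sqrtr0// => j _; rewrite mxE mul0r. Qed.

Lemma enormZ c x : enorm (c *: x) = `|c| * enorm x.
Proof.
by rewrite /enorm dotpZl dotpZr mulrA -expr2 sqrtrM ?sqr_ge0// sqrtr_sqr.
Qed.

Lemma enormN x : enorm (- x) = enorm x.
Proof. by rewrite -scaleN1r enormZ normrN1 mul1r. Qed.

Lemma edistC x y : edist x y = edist y x.
Proof. by rewrite /edist -enormN opprB. Qed.

(** Cauchy-Schwarz, from the nonnegativity of |<y,y> x - <x,y> y|^2. *)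
Lemma dotp_le_enorm x y : dotp x y <= enorm x * enorm y.
Proof.
have [y0|y0] := eqVneq (dotp y y) 0.
  suff -> : dotp x y = 0 by rewrite mulr_ge0 ?enorm_ge0.
  rewrite /dotp big1// => j _.
  move/eqP: y0; rewrite psumr_eq0 => [/allP/(_ j (mem_index_enum _))/=|i _].
    by rewrite mulf_eq0 orbb => /eqP ->; rewrite mulr0.
  by rewrite -expr2 sqr_ge0.
have yy : 0 < dotp y y by rewrite lt0r y0 dotp_ge0.
have := dotp_ge0 (dotp y y *: x - dotp x y *: y).
rewrite !(dotpDl, dotpDr, dotpNl, dotpNr, dotpZl, dotpZr) (dotpC y x) => h.
have {}h : 0 <= dotp x x * dotp y y - dotp x y ^+ 2.
  rewrite -(pmulr_rge0 _ yy); apply: le_trans h _.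
  by rewrite le_eqVlt; apply/orP; left; apply/eqP; ring.
rewrite (le_trans (ler_norm _))// -ler_sqr ?nnegrE ?mulr_ge0 ?enorm_ge0//.
by rewrite exprMn !sqr_enorm real_normK ?num_real// -subr_ge0.
Qed.

Lemma enormD x y : enorm (x + y) <= enorm x + enorm y.
Proof.
rewrite -ler_sqr ?nnegrE ?addr_ge0 ?enorm_ge0// sqrrD !sqr_enorm.
rewrite dotpDl !dotpDr (dotpC y x) -addrA (addrA (dotp x y)) addrA lerD2r.
by rewrite lerD2l -mulr2n lerMn2r dotp_le_enorm.
Qed.

Lemma normr_dotp_le x y : `|dotp x y| <= enorm x * enorm y.
Proof.
by rewrite ler_norml lerNl -dotpNl -{1}(enormN x) !dotp_le_enorm.
Qed.

Lemma dotp_lipschitz p x y : `|dotp p x - dotp p y| <= enorm p * edist x y.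
Proof. by rewrite -dotpNr -dotpDr normr_dotp_le. Qed.

Lemma enorm_sub_le_edist x y z : enorm (x - z) <= edist x y + enorm (y - z).
Proof.
have -> : x - z = x - y + (y - z) by rewrite addrA subrK.
exact: enormD.
Qed.

Lemma enorm_sub_lipschitz z x y :
  `|enorm (x - z) - enorm (y - z)| <= 1 * edist x y.
Proof.
rewrite mul1r ler_distl lerBlDr; apply/andP; split; rewrite [leRHS]addrC.
  by rewrite edistC; exact: enorm_sub_le_edist.
exact: enorm_sub_le_edist.
Qed.

Lemma enorm_sum (I : finType) (F : I -> 'rV[R]_m) :
  enorm (\sum_i F i) <= \sum_i enorm (F i).
Proof.
elim/big_ind2: _ => [|x1 x2 y1 y2 h1 h2|//]; first by rewrite enorm0.
exact: le_trans (enormD _ _) (lerD h1 h2).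
Qed.

Lemma coord_le_enorm x j : `|x 0 j| <= enorm x.
Proof.
rewrite -ler_sqr ?nnegrE ?enorm_ge0// sqr_enorm real_normK ?num_real//.
rewrite /dotp (bigD1 j)//= -expr2 lerDl.
by apply: sumr_ge0 => i _; rewrite -expr2 sqr_ge0.
Qed.

Lemma enorm_le_sum x : enorm x <= \sum_j `|x 0 j|.
Proof.
rewrite {1}(row_sum_delta x); apply: le_trans (enorm_sum _) _.
apply: ler_sum => j _; rewrite enormZ ler_piMr// /enorm /dotp.
rewrite (bigD1 j)//= big1 => [|i /negPf ij]; rewrite !mxE ?eqxx ?ij ?mulr0//.
by rewrite mulr1 addr0 sqrtr1.
Qed.

Lemma edist_lt_exists_rat x (e : R) : 0 < e ->
  exists q : 'rV[rat]_m, edist x (map_mx ratr q) < e.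
Proof.
move=> e0; have d0 : 0 < e / m.+1%:R by rewrite divr_gt0.
have /choice [q hq] : forall j, exists r : rat, `|x 0 j - ratr r| < e / m.+1%:R.
  move=> j; have /rat_in_itvoo [r] : x 0 j - e / m.+1%:R < x 0 j + e / m.+1%:R.
    by rewrite ltrD2l gtrN.
  by rewrite in_itv/= => hr; exists r; rewrite distrC ltr_distl.
exists (\row_j q j); rewrite /edist; apply: le_lt_trans (enorm_le_sum _) _.
apply: (@le_lt_trans _ _ (\sum_(j < m) e / m.+1%:R)).
  by apply: ler_sum => j _; rewrite !mxE ltW.
rewrite sumr_const card_ord -[X in X < _]mulr_natr mulrAC ltr_pdivrMr//.
by rewrite ltr_pM2l// ltr_nat.
Qed.

Lemma dist_to_ge0 A x : 0 <= dist_to A x.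
Proof. by apply: inf_nonneg => _ [a _ <-]; exact: enorm_ge0. Qed.

Lemma dist_to_le A x a : A a -> dist_to A x <= enorm (x - a).
Proof.
move=> Aa; apply: ge_inf; last by exists a.
by exists 0 => _ [b _ <-]; exact: enorm_ge0.
Qed.

Lemma le_dist_to A x c : A !=set0 -> (forall a, A a -> c <= enorm (x - a)) ->
  c <= dist_to A x.
Proof.
move=> [a Aa] h; apply: lb_le_inf; first by exists (enorm (x - a)), a.
by move=> _ [b Ab <-]; exact: h.
Qed.

Lemma dist_to_lipschitz A x y : A !=set0 ->
  `|dist_to A x - dist_to A y| <= 1 * edist x y.
Proof.
move=> A0; rewrite mul1r.
suff h u v : dist_to A u <= dist_to A v + edist u v.
  by rewrite ler_distl h lerBlDr edistC h.
rewrite -lerBlDr; apply: le_dist_to => // a Aa; rewrite lerBlDr.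
apply: le_trans (dist_to_le _ Aa) _; rewrite [leRHS]addrC.
exact: enorm_sub_le_edist.
Qed.

End euclidean_geometry.

Lemma edist_row_mxr {R : realType} {m p : nat} (x : 'rV[R]_m) (u v : 'rV[R]_p) :
  edist (row_mx x u) (row_mx x v) = edist u v.
Proof.
rewrite /Defs.edist /enorm /dotp opp_row_mx add_row_mx subrr big_split_ord/=.
rewrite big1 ?add0r => [|j _]; last by rewrite row_mxEl mxE mul0r.
by under eq_bigr do rewrite row_mxEr.
Qed.

Lemma edist_row_mxl {R : realType} {m p : nat} (u : 'rV[R]_p) (x y : 'rV[R]_m) :
  edist (row_mx x u) (row_mx y u) = edist x y.
Proof.
rewrite /Defs.edist /enorm /dotp opp_row_mx add_row_mx subrr big_split_ord/=.
rewrite addrC big1 ?add0r => [|j _]; last by rewrite row_mxEr mxE mul0r.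
by under eq_bigr do rewrite row_mxEl.
Qed.

Lemma linear_lipschitz {R : realType} {m p : nat}
    (f : 'rV[R]_m -> 'rV[R]_p) : linear f ->
  exists2 C, 0 <= C & forall x y, edist (f x) (f y) <= C * edist x y.
Proof.
move=> lf; pose g : {linear 'rV[R]_m -> 'rV[R]_p} :=
  HB.pack f (GRing.isLinear.Build _ _ _ _ f lf).
suff [C C0 gC] : exists2 C, 0 <= C & forall x, enorm (g x) <= C * enorm x.
  exists C => // x y.
  by rewrite /Defs.edist -[f x]/(g x) -[f y]/(g y) -linearB gC.
exists (\sum_(j < m) enorm (g (delta_mx 0 j))) => [|x].
  by apply: sumr_ge0 => j _; exact: enorm_ge0.
rewrite {1}(row_sum_delta x) linear_sum (le_trans (enorm_sum _))// mulr_suml.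
apply: ler_sum => j _; rewrite linearZ enormZ mulrC.
by rewrite ler_wpM2l ?enorm_ge0 ?coord_le_enorm.
Qed.

(** * Measurability of Lipschitz functions of random vectors *)

Lemma measurable_fun_sqrt {R : realType} : measurable_fun setT (@Num.sqrt R).
Proof. exact: continuous_measurable_fun (@sqrt_continuous R). Qed.

(** By density of the rational points q, an L-Lipschitz g is the countable
    infimum of the functions g q + L |x - q|, each of which depends measurably
    on the coordinates of x. *)
Lemma measurable_fun_lipschitz_comp {d} {T : measurableType d} {R : realType}
    {m : nat} (g : 'rV[R]_m -> R) (L : R) (X : T -> 'rV[R]_m) :
    (forall x y, `|g x - g y| <= L * edist x y) ->
    (forall j, measurable_fun setT (fun w => X w 0 j)) ->
  measurable_fun setT (g \o X).
Proof.
move=> gL mX.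
pose q k : 'rV[R]_m := map_mx ratr (odflt 0 (unpickle k) : 'rV[rat]_m).
pose h k w := g (q k) + `|L| * edist (X w) (q k).
have gh k w : g (X w) <= h k w.
  rewrite /h -lerBlDl; apply: le_trans (ler_norm _) (le_trans (gL _ _) _).
  by rewrite ler_wpM2r ?enorm_ge0 ?ler_norm.
have -> : g \o X = fun w => infs (h^~ w) 0.
  apply/funext => w; apply/eqP; rewrite eq_le; apply/andP; split.
    apply: lb_le_inf; first by exists (h 0%N w), 0%N.
    by move=> _ [k _ <-]; exact: gh.
  apply/ler_addgt0Pl => e e0.
  (* At q within e / (2L + 1) of X w, the function exceeds g (X w) by at most
     2L |X w - q|: once for g q, once for the penalty. *)
  have c0 : 0 < 2 * `|L| + 1 by rewrite ltr_wpDl// mulr_ge0.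
  have [r hr] := edist_lt_exists_rat (X w) (divr_gt0 e0 c0).
  apply: (@le_trans _ _ (h (pickle r) w)).
    apply: ge_inf; last by exists (pickle r).
    by exists (g (X w)) => _ [k _ <-]; exact: gh.
  rewrite /h /q pickleK/=; move: hr; set D := edist _ _ => hr.
  have D0 : 0 <= D by exact: enorm_ge0.
  have : g (map_mx ratr r) - g (X w) <= `|L| * D.
    apply: le_trans (ler_norm _) _; rewrite distrC; apply: le_trans (gL _ _) _.
    by rewrite ler_wpM2r// ler_norm.
  have : (2 * `|L| + 1) * D <= e by rewrite mulrC -ler_pdivlMr// ltW.
  by lra.
apply: measurable_fun_infs => [w _|k].
  by exists (g (X w)) => _ [k _ <-]; exact: gh.
apply: measurable_funD => //; apply: measurable_funM => //.
apply: measurableT_comp; first exact: measurable_fun_sqrt.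
apply: measurable_sum => j; under eq_fun do rewrite !mxE.
by apply: measurable_funM; apply: measurable_funB.
Qed.

(** * Approximation by bounded Lipschitz functions *)

(** The form in which pointwise estimates are integrated before integrability
    is known. *)
Lemma integral_affine_le {d} {T : measurableType d} {R : realType}
    (P : probability T R) (f g h : T -> R) (a b c y z : R) :
    measurable_fun setT f -> measurable_fun setT g -> measurable_fun setT h ->
    0 <= a -> 0 <= b -> 0 <= c ->
    (forall w, 0 <= f w) -> (forall w, 0 <= g w) -> (forall w, 0 <= h w) ->
    (forall w, f w <= a + b * g w + c * h w) ->
    (\int[P]_w (g w)%:E <= y%:E)%E -> (\int[P]_w (h w)%:E <= z%:E)%E ->
  (\int[P]_w (f w)%:E <= (a + b * y + c * z)%:E)%E.
Proof.
move=> mf mg mh a0 b0 c0 f0 g0 h0 fgh gy hz.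
have mbg : measurable_fun setT (fun w => b * g w) by exact: measurable_funM.
have mch : measurable_fun setT (fun w => c * h w) by exact: measurable_funM.
apply: (@le_trans _ _ (\int[P]_w ((a + b * g w) + c * h w)%:E)%E).
  apply: ge0_le_integral => [//|w _||| w _].
  - by rewrite lee_fin.
  - exact/measurable_EFinP.
  - by apply/measurable_EFinP; do ! apply: measurable_funD => //.
  - by rewrite lee_fin.
under eq_integral do rewrite EFinD.
have ab0 w : setT w -> (0 <= (a + b * g w)%:E)%E.
  by move=> _; rewrite lee_fin addr_ge0// mulr_ge0.
have bg0 w : setT w -> (0 <= (b * g w)%:E)%E by rewrite lee_fin mulr_ge0.
have ch0 w : setT w -> (0 <= (c * h w)%:E)%E by rewrite lee_fin mulr_ge0.
rewrite (ge0_integralD _ measurableT ab0 _ ch0); last 2 first.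
- by apply/measurable_EFinP; apply: measurable_funD.
- exact/measurable_EFinP.
under eq_integral do rewrite EFinD.
rewrite (ge0_integralD _ measurableT _ _ bg0)//; last exact/measurable_EFinP.
under [X in (_ + X + _)%E]eq_integral do rewrite EFinM.
under [X in (_ + _ + X)%E]eq_integral do rewrite EFinM.
rewrite !ge0_integralZl//; try exact/measurable_EFinP;
  try by move=> w _; rewrite lee_fin.
rewrite integral_cst// [X in (_ * X)%E]probability_setT mule1 !EFinD !EFinM.
by rewrite !leeD// lee_wpmul2l.
Qed.

Section bounded_lipschitz_approximation.
Context {R : realType} {Omega : completeMetricType R}.
Local Notation T := (borelType Omega).
Implicit Types (PP : set (probability T R)) (X u v : Omega -> R).

Lemma measurable_CbLip u : CbLip u -> measurable_fun setT (u : T -> R).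
Proof.
move=> [_ [L uL]].
have cu : continuous u.
  move=> x; apply/cvgrPdist_lt => e e0; apply/nbhs_ballP.
  have L0 : 0 < `|L| + 1 by rewrite ltr_wpDl.
  exists (e / (`|L| + 1)) => [|y]; first exact: divr_gt0.
  rewrite ballEmdist/= ltr_pdivlMr// => xy.
  apply: le_lt_trans (uL _ _) (le_lt_trans _ xy).
  rewrite mulrC ler_wpM2l ?mdist_ge0//.
  by rewrite (le_trans (ler_norm _))// lerDl.
apply: (measurability _ (RGenOpens.measurableE R)).
move=> _ [_ [a [b ->] <-]]; rewrite setTI; apply: sub_sigma_algebra.
by move/continuousP : cu; apply; exact: interval_open.
Qed.

Lemma CbLip_sqr u : CbLip u -> CbLip (fun w => u w ^+ 2).
Proof.
move=> [[M uM] [L uL]]; split.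
  by exists (M ^+ 2) => w; rewrite normrX lerXn2r ?nnegrE// (le_trans _ (uM w)).
exists (2 * `|M| * L) => x y; rewrite subr_sqr normrM mulrC -[leRHS]mulrA.
apply: ler_pM => //; apply: le_trans (ler_normD _ _) _.
by rewrite mulr_natl mulr2n lerD// (le_trans (uM _))// ler_norm.
Qed.

Lemma CbLip_lipschitz_comp m (g : 'rV[R]_m -> R) (L : R)
    (u : 'I_m -> Omega -> R) :
    (forall x y, `|g x - g y| <= L * edist x y) -> (forall j, CbLip (u j)) ->
  CbLip (fun w => g (\row_j u j w)).
Proof.
move=> gL uC.
have {}gL x y : `|g x - g y| <= `|L| * \sum_j `|(x - y) 0 j|.
  apply: le_trans (gL x y) _.
  apply: le_trans (ler_wpM2l (normr_ge0 L) (enorm_le_sum _)).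
  by rewrite ler_wpM2r ?enorm_ge0// ler_norm.
have /choice [M uM] j := (uC j).1.
have /choice [K uK] j := (uC j).2.
split.
  exists (`|g 0| + `|L| * \sum_j M j) => w.
  rewrite -lerBlDl (le_trans (lerB_dist _ _))// (le_trans (gL _ _))//.
  by rewrite ler_wpM2l//; apply: ler_sum => j _; rewrite subr0 mxE.
exists (`|L| * \sum_j K j) => x y; apply: le_trans (gL _ _) _.
rewrite -mulrA ler_wpM2l// mulr_suml; apply: ler_sum => j _.
by rewrite !mxE.
Qed.

(** Membership in L^p for an integer p, with the supremum over PP and the p-th
    root removed: the bound on the error holds under every P in PP. *)
Definition approximable PP (p : nat) X : Prop :=
  measurable_fun setT (X : T -> R) /\
  forall e : R, 0 < e -> exists2 u, CbLip u &
    forall P, PP P -> (\int[P]_w (`|u w - X w| ^+ p)%:E <= e%:E)%E.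

Lemma measurable_approx_error u X p : CbLip u ->
  measurable_fun setT (X : T -> R) ->
  measurable_fun setT ((fun w => `|u w - X w| ^+ p) : T -> R).
Proof.
move=> uC mX; apply: measurable_funX; apply: measurableT_comp => //.
by apply: measurable_funB => //; exact: measurable_CbLip.
Qed.

(** Approximate each coordinate by u_j and use g (u_1, ..., u_m): the Lipschitz
    bound controls the squared error by L^2 times the sum of the squared errors
    of the coordinates. The approximant is bounded even when g is not, because
    the u_j are bounded. *)
Lemma approximable_lipschitz_comp PP m (g : 'rV[R]_m -> R) (L : R)
    (X : Omega -> 'rV[R]_m) :
    (forall x y, `|g x - g y| <= L * edist x y) ->
    (forall j, approximable PP 2 (fun w => X w 0 j)) ->
  approximable PP 2 (g \o X).
Proof.
move=> gL aX.
have mX j : measurable_fun setT ((fun w => X w 0 j) : T -> R) := (aX j).1.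
have mgX : measurable_fun setT (g \o X : T -> R).
  exact: measurable_fun_lipschitz_comp gL mX.
split=> // e e0.
pose c : R := L ^+ 2 * m%:R + 1; have c0 : 0 < c.
  by rewrite ltr_wpDl// mulr_ge0 ?sqr_ge0.
have /choice [u hu] j : exists u, CbLip u /\ forall P, PP P ->
    (\int[P]_w (`|u w - X w 0 j| ^+ 2)%:E <= (e / c)%:E)%E.
  by have [u ? ?] := (aX j).2 _ (divr_gt0 e0 c0); exists u.
have uC j : CbLip (u j) by case: (hu j).
exists (fun w => g (\row_j u j w)).
  by apply: CbLip_lipschitz_comp gL _.
move=> P PPP.
pose s w := \sum_j `|u j w - X w 0 j| ^+ 2.
have ms : measurable_fun setT (s : T -> R).
  by apply: measurable_sum => j; exact: measurable_approx_error.
have sP : (\int[P]_w (s w)%:E <= (m%:R * (e / c))%:E)%E.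
  under eq_integral do rewrite -sumEFin.
  rewrite ge0_integral_sum//; last first.
    by move=> j; apply/measurable_EFinP; exact: measurable_approx_error.
  apply: (@le_trans _ _ (\sum_(j < m) (e / c)%:E)%E).
    by apply: lee_sum => j _; exact: (hu j).2.
  by rewrite sumEFin sumr_const card_ord mulr_natl.
have s0 w : 0 <= s w by apply: sumr_ge0 => j _; exact: sqr_ge0.
have gs w : `|g (\row_j u j w) - g (X w)| ^+ 2 <= 0 + L ^+ 2 * s w + 0 * s w.
  rewrite mul0r addr0 add0r.
  have -> : s w = edist (\row_j u j w) (X w) ^+ 2.
    rewrite sqr_enorm; apply: eq_bigr => j _.
    by rewrite !mxE -expr2 real_normK ?num_real.
  by rewrite -exprMn lerXn2r ?nnegrE// (le_trans _ (gL _ _)).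
apply: (le_trans (integral_affine_le _ ms ms _ _ _ _ s0 s0 gs sP sP)) => //.
- by apply: measurable_approx_error => //; exact: CbLip_lipschitz_comp gL _.
- by rewrite sqr_ge0.
- rewrite lee_fin add0r mul0r addr0 !mulrA ler_pdivrMr// [leRHS]mulrC.
  by rewrite ler_wpM2r ?(ltW e0)// lerDl.
Qed.

(** L^2 is contained in L^1: |r| <= e/2 + r^2/(2e) replaces the Cauchy-Schwarz
    inequality for integrals. *)
Lemma approximable_sub21 PP X : approximable PP 2 X -> approximable PP 1 X.
Proof.
move=> [mX aX]; split=> // e e0.
have [u uC hu] := aX (e ^+ 2) (exprn_gt0 _ e0).
exists u => // P PPP; have hP := hu P PPP.
have me := measurable_approx_error 2 uC mX.
have b0 : 0 <= (2 * e)^-1 by rewrite invr_ge0 mulr_ge0// ltW.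
have h w : `|u w - X w| ^+ 1 <=
    e / 2 + (2 * e)^-1 * `|u w - X w| ^+ 2 + 0 * `|u w - X w| ^+ 2.
  set r := `|_|; rewrite expr1 mul0r addr0 -subr_ge0.
  have -> : e / 2 + (2 * e)^-1 * r ^+ 2 - r = (2 * e)^-1 * (r - e) ^+ 2.
    by field; rewrite gt_eqF.
  by rewrite mulr_ge0 ?sqr_ge0.
apply: (le_trans (integral_affine_le _ me me _ b0 _ _ _ _ h hP hP)) => //.
- exact: measurable_approx_error.
- by rewrite divr_ge0// ltW.
- rewrite mul0r addr0 lee_fin le_eqVlt; apply/orP; left; apply/eqP.
  by field; rewrite gt_eqF.
Qed.

(** If u approximates X in L^2, then u^2 approximates X^2 in L^1. With
    t = u - X, u^2 - X^2 = t^2 + 2 t X, and 2 |t X| <= r X^2 + t^2/r. The weight r can be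
    fixed before u because X^2 is bounded in mean, uniformly in P: it is at most
    2 v^2 + 2 (v - X)^2 for a fixed bounded v at L^2 distance at most 1. *)
Lemma approximable_sqr PP X : approximable PP 2 X ->
  approximable PP 1 (fun w => X w ^+ 2).
Proof.
move=> [mX aX]; split=> [|e e0]; first exact: measurable_funX.
have [v vC hv] := aX 1 ltr01.
have [M vM] : exists M : R, forall w, `|v w| <= M.
  by case: vC => -[M ?]; exists M.
pose B : R := 2 * M ^+ 2 + 2; have B0 : 0 < B.
  by rewrite ltr_wpDl// mulr_ge0 ?sqr_ge0.
pose r : R := e / (2 * B); have r0 : 0 < r by rewrite divr_gt0// mulr_gt0.
pose c : R := 1 + r^-1; have c0 : 0 < c by rewrite addr_gt0// invr_gt0.
have [u uC hu] := aX (e / (2 * c)) (divr_gt0 e0 (mulr_gt0 (ltr0n R 2) c0)).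
exists (fun w => u w ^+ 2); first exact: CbLip_sqr.
move=> P PPP.
have h w : `|u w ^+ 2 - X w ^+ 2| ^+ 1 <=
    2 * r * M ^+ 2 + (2 * r) * `|v w - X w| ^+ 2 + c * `|u w - X w| ^+ 2.
  have x2 : X w ^+ 2 <= 2 * M ^+ 2 + 2 * `|v w - X w| ^+ 2.
    have : v w ^+ 2 <= M ^+ 2.
      by rewrite -real_normK ?num_real// lerXn2r ?nnegrE// (le_trans _ (vM w)).
    have := sqr_ge0 (2 * v w - X w).
    by rewrite real_normK ?num_real//; lra.
  have y2 : `|u w ^+ 2 - X w ^+ 2| <= r * X w ^+ 2 + c * `|u w - X w| ^+ 2.
    rewrite real_normK ?num_real//; set t := u w - X w.
    have -> : u w ^+ 2 - X w ^+ 2 = t ^+ 2 + 2 * t * X w by rewrite /t; ring.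
    (* Completing the square, for both signs s of the cross term. *)
    have q s : 0 <= r * (X w + s * t / r) ^+ 2.
      by rewrite mulr_ge0 ?sqr_ge0 ?ltW.
    have q2 s : r * (X w + s * t / r) ^+ 2 =
        r * X w ^+ 2 + 2 * s * t * X w + r^-1 * (s * t) ^+ 2.
      by field; rewrite gt_eqF.
    have q1 := q 1; have qN := q (-1); rewrite !q2 in q1 qN.
    have t2 := sqr_ge0 t.
    by rewrite ler_norml /c; apply/andP; split; lra.
  rewrite expr1; apply: le_trans y2 _; rewrite lerD2r.
  by have := ler_wpM2l (ltW r0) x2; lra.
have me := measurable_approx_error 2 vC mX.
have mf := measurable_approx_error 2 uC mX.
apply: (le_trans (integral_affine_le _ me mf _ _ (ltW c0) _ _ _ h
  (hv P PPP) (hu P PPP))) => //.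
- by apply: measurable_approx_error; [exact: CbLip_sqr|exact: measurable_funX].
- by rewrite mulr_ge0 ?sqr_ge0// mulr_ge0// ltW.
- by rewrite mulr_ge0// ltW.
- rewrite lee_fin le_eqVlt; apply/orP; left; apply/eqP.
  have -> : 2 * r * M ^+ 2 + 2 * r * 1 + c * (e / (2 * c)) =
    r * B + c * (e / (2 * c)) by rewrite /B; ring.
  by rewrite /r; field; rewrite !gt_eqF.
Qed.

End bounded_lipschitz_approximation.

(** * The extended expectation as a supremum of means *)

Section upper_norm_convergence.
Context {R : realType} {Omega : completeMetricType R}.
Local Notation T := (borelType Omega).
Implicit Types (PP : set (probability T R)) (X u v : Omega -> R).

Lemma expectationE (P : probability T R) X :
  ('E_P[(X : T -> R)] = \int[P]_w (X w)%:E)%E.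
Proof. by rewrite unlock. Qed.

Lemma upper_expectation_norm_ge0 PP X (p : nat) : PP !=set0 ->
  (0 <= upper_expectation PP (fun w => `|X w| `^ p%:R)%R)%E.
Proof.
move=> [P PPP]; apply: le_ereal_sup_tmp.
exists ('E_P[((fun w => `|X w| `^ p%:R)%R : T -> R)])%E; first by exists P.
by rewrite expectationE; apply: integral_ge0 => w _; rewrite lee_fin powR_ge0.
Qed.

Lemma Lp_approx_near PP (p : nat) (u : nat -> Omega -> R) X (e : R) :
    PP !=set0 -> (0 < p)%N -> 0 < e -> Lp_approx PP p%:R u X ->
  \forall k \near \oo, forall P, PP P ->
    (\int[P]_w (`|u k w - X w| ^+ p)%:E <= e%:E)%E.
Proof.
move=> PP0 p0 e0 [uC uX].
have r0 : 0 < e `^ p%:R^-1 by rewrite powR_gt0.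
have : \forall k \near \oo,
    (upper_norm PP p%:R (u k \- X)%R < ((e `^ p%:R^-1)%R)%:E)%E.
  apply: (uX [set x | (x < ((e `^ p%:R^-1)%R)%:E)%E]).
  by apply: open_ereal_lt'; rewrite lte_fin.
apply: filterS => k /= + P PPP.
rewrite /upper_norm; set s := upper_expectation _ _ => hs.
have s0 : (0 <= s)%E by exact: upper_expectation_norm_ge0.
have se : (s <= e%:E)%E.
  rewrite leNgt; apply/negP => es.
  suff : (((e `^ p%:R^-1)%R)%:E <= s `^ p%:R^-1)%E by rewrite leNgt hs.
  rewrite -poweR_EFin; apply: gt0_ler_poweR; last exact: ltW.
  - by rewrite invr_ge0.
  - by rewrite in_itv/= lee_fin ltW//= leey.
  - by rewrite in_itv/= s0 leey.
apply: le_trans se; apply: ereal_sup_ubound; exists P => //.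
rewrite expectationE; apply: eq_integral => w _ /=.
by rewrite powR_mulrn.
Qed.

Lemma Lp_approximable PP (p : nat) X : PP !=set0 -> (0 < p)%N ->
  Lp PP p%:R X -> approximable PP p X.
Proof.
move=> PP0 p0 [mX [u uX]]; split=> // e e0.
have [k hk] := filter_ex (Lp_approx_near PP0 p0 e0 uX).
by exists (u k) => //; exact: uX.1.
Qed.

Lemma Lp_approx_of_error_le PP (u : nat -> Omega -> R) X : PP !=set0 ->
    (forall k, CbLip (u k)) ->
    (forall k P, PP P ->
      (\int[P]_w (`|u k w - X w| ^+ 1)%:E <= k.+1%:R^-1%:E)%E) ->
  Lp_approx PP 1 u X.
Proof.
move=> PP0 uC uX; split=> //.
apply: (@squeeze_cvge _ _ _ _ (cst 0%E) _ (fun k => k.+1%:R^-1%:E)).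
- apply: nearW => k /=; rewrite /upper_norm invr1.
  have s0 := upper_expectation_norm_ge0 (u k \- X) 1 PP0.
  rewrite poweRe1// s0/=; apply: ge_ereal_sup => _ [P PPP <-].
  rewrite expectationE; apply: le_trans (uX k P PPP).
  by rewrite le_eqVlt; apply/orP; left; apply/eqP; apply: eq_integral => w _ /=;
    rewrite powRr1.
- exact: cvg_cst.
- apply/fine_cvgP; split; first exact: nearW.
  exact: cvg_harmonic.
Qed.

Lemma approximable_integrable PP X P : approximable PP 1 X -> PP P ->
  P.-integrable setT (EFin \o (X : T -> R)).
Proof.
move=> [mX aX] PPP.
have [u uC hu] := aX 1 ltr01.
have [M uM] : exists M : R, forall w, `|u w| <= M.
  by case: uC => -[M ?]; exists M.
apply/integrableP; split; first exact/measurable_EFinP.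
have mu := measurable_approx_error 1 uC mX.
apply: (@le_lt_trans _ _ (`|M| + 1 * 1 + 0 * 1)%:E); last exact: ltry.
apply: (integral_affine_le _ mu mu) => //; try exact: hu.
- by apply: measurableT_comp.
move=> w; rewrite mul0r addr0 mul1r expr1 -lerBlDr.
have := ler_normB (u w) (u w - X w); rewrite opprB addrC subrK.
by have := ler_norm M; have := uM w; lra.
Qed.

Lemma CbLip_approximable PP p u : (0 < p)%N -> CbLip u -> approximable PP p u.
Proof.
move=> p0 uC; split=> [|e e0]; first exact: measurable_CbLip.
exists u => // P PPP; rewrite (eq_integral (cst 0%E)) => [|w _].
  by rewrite integral0 lee_fin ltW.
by rewrite subrr normr0 expr0n gtn_eqF.
Qed.

Lemma normr_RintegralB_le PP X u P (e : R) : CbLip u -> approximable PP 1 X ->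
    PP P -> (\int[P]_w (`|u w - X w| ^+ 1)%:E <= e%:E)%E ->
  `|\int[P]_w (u : T -> R) w - \int[P]_w (X : T -> R) w| <= e.
Proof.
move=> uC aX PPP he.
have iX := approximable_integrable aX PPP.
have iu := approximable_integrable (CbLip_approximable PP (ltnSn 0) uC) PPP.
have iB : P.-integrable setT (EFin \o (fun w : T => u w - X w)).
  exact: (integrableB measurableT iu iX).
rewrite -RintegralB//; apply: le_trans (le_normr_Rintegral _ iB) _ => //.
rewrite -lee_fin; apply: le_trans he; rewrite /Rintegral fineK//.
by apply: integrable_fin_num => //; exact: (integrable_norm iB).
Qed.

End upper_norm_convergence.

Section extension.
Context {R : realType} {Omega : completeMetricType R}.
Local Notation T := (borelType Omega).
Context (E : (Omega -> R) -> R) (PP : set (probability T R)).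
Hypothesis hPP : represents PP E.
Implicit Types (X u v : Omega -> R).

(** Otherwise E 0 would be the supremum of the empty set in the extended reals,
    which is not finite. *)
Lemma representing_nonempty : PP !=set0.
Proof.
apply/set0P/eqP => PP0.
have c0 : CbLip (cst 0 : Omega -> R).
  by split; [exists 0 => x|exists 0 => x y]; rewrite ?subrr normr0 ?mul0r.
have := represents_sup hPP c0.
by rewrite /upper_expectation PP0 image_set0 ereal_sup0.
Qed.

Lemma EFin_Rintegral X P : approximable PP 1 X -> PP P ->
  ((\int[P]_w (X : T -> R) w)%:E = 'E_P[(X : T -> R)])%E.
Proof.
move=> aX PPP; rewrite expectationE fineK//.
by apply: integrable_fin_num => //; exact: approximable_integrable aX PPP.
Qed.

Lemma Rintegral_le_CbLip u P : CbLip u -> PP P ->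
  \int[P]_w (u : T -> R) w <= E u.
Proof.
move=> uC PPP; rewrite -lee_fin (represents_sup hPP uC).
rewrite (EFin_Rintegral (CbLip_approximable _ (ltnSn 0) uC) PPP).
by apply: ereal_sup_ubound; exists P.
Qed.

Lemma sle_CbLip_le u (c : R) : CbLip u ->
  (forall P, PP P -> \int[P]_w (u : T -> R) w <= c) -> E u <= c.
Proof.
move=> uC h; rewrite -lee_fin (represents_sup hPP uC).
apply: ge_ereal_sup => _ [P PPP <-].
by rewrite -(EFin_Rintegral (CbLip_approximable _ (ltnSn 0) uC) PPP) lee_fin h.
Qed.

Lemma has_sup_Rintegral X : approximable PP 1 X ->
  has_sup [set \int[P]_w (X : T -> R) w | P in PP].
Proof.
move=> aX; split.
  by have [P PPP] := representing_nonempty; exists (\int[P]_w X w); exists P.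
have [u uC hu] := aX.2 1 ltr01; exists (E u + 1) => _ [P PPP <-].
have := normr_RintegralB_le uC aX PPP (hu P PPP).
by have := Rintegral_le_CbLip uC PPP; rewrite ler_norml => ? /andP[]; lra.
Qed.

(** E u is itself a supremum of means, and a uniform error of e moves every
    mean, hence their supremum, by at most e. *)
Lemma normr_sleB_sup_Rintegral_le X u (e : R) :
    CbLip u -> approximable PP 1 X ->
    (forall P, PP P -> (\int[P]_w (`|u w - X w| ^+ 1)%:E <= e%:E)%E) ->
  `|E u - sup [set \int[P]_w (X : T -> R) w | P in PP]| <= e.
Proof.
move=> uC aX hu; have [n0 ub] := has_sup_Rintegral aX.
rewrite ler_distl; apply/andP; split.
  rewrite lerBlDr; apply: ge_sup => // _ [P PPP <-].
  have := normr_RintegralB_le uC aX PPP (hu P PPP).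
  by have := Rintegral_le_CbLip uC PPP; rewrite ler_norml => ? /andP[]; lra.
apply: sle_CbLip_le => // P PPP.
have : \int[P]_w X w <= sup [set \int[P]_w (X : T -> R) w | P in PP].
  by apply: ub_le_sup => //; exists P.
have := normr_RintegralB_le uC aX PPP (hu P PPP).
by rewrite ler_norml => /andP[]; lra.
Qed.

(** Along every approximating sequence E (u k) converges to the supremum of the
    means, so the limit that defines the extension exists, does not depend on
    the sequence, and is this supremum. *)
Lemma sle_extE X : approximable PP 1 X ->
  sle_ext PP E X = sup [set \int[P]_w (X : T -> R) w | P in PP].
Proof.
move=> aX; have PP0 := representing_nonempty.
have cvgE (v : nat -> Omega -> R) : Lp_approx PP 1 v X ->
    E (v k) @[k --> \oo] --> sup [set \int[P]_w (X : T -> R) w | P in PP].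
  move=> vX; apply/cvgrPdist_le => e e0.
  apply: filterS (Lp_approx_near PP0 (ltnSn 0) e0 vX) => k hk.
  by rewrite distrC normr_sleB_sup_Rintegral_le//; exact: vX.1.
rewrite /sle_ext; case: xgetP => [l _ [v vX vl]|h].
  exact: (cvg_unique _ vl (cvgE v vX)).
have /choice [v hv] k : exists u, CbLip u /\ forall P, PP P ->
    (\int[P]_w (`|u w - X w| ^+ 1)%:E <= k.+1%:R^-1%:E)%E.
  by have [|u ? ?] := aX.2 k.+1%:R^-1; [rewrite invr_gt0|exists u].
have vX : Lp_approx PP 1 v X.
  by apply: Lp_approx_of_error_le => // k; case: (hv k).
case: (h (sup [set \int[P]_w (X : T -> R) w | P in PP])).
by exists v => //; exact: cvgE.
Qed.

Lemma Rintegral_le_sle_ext X P : approximable PP 1 X -> PP P ->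
  \int[P]_w (X : T -> R) w <= sle_ext PP E X.
Proof.
move=> aX PPP; rewrite sle_extE//; apply: ub_le_sup; last by exists P.
by case: (has_sup_Rintegral aX).
Qed.

Lemma sle_ext_le X (c : R) : approximable PP 1 X ->
  (forall P, PP P -> \int[P]_w (X : T -> R) w <= c) -> sle_ext PP E X <= c.
Proof.
move=> aX h; rewrite sle_extE//.
apply: ge_sup => [|_ [P PPP <-]]; last exact: h.
by case: (has_sup_Rintegral aX).
Qed.

End extension.

(** * Means of combinations and of linear functionals *)

Lemma Rintegral_le_affine {d} {T : measurableType d} {R : realType}
    (P : probability T R) (h f g : T -> R) (a b c : R) :
    P.-integrable setT (EFin \o h) -> P.-integrable setT (EFin \o f) ->
    P.-integrable setT (EFin \o g) ->
    (forall w, h w <= a + b * f w + c * g w) ->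
  \int[P]_w h w <= a + b * \int[P]_w f w + c * \int[P]_w g w.
Proof.
move=> hi fi gi hfg.
have ai : P.-integrable setT (EFin \o cst a).
  exact: finite_measure_integrable_cst.
have bfi : P.-integrable setT (EFin \o (fun w => b * f w)).
  exact: (integrableZl measurableT b fi).
have cgi : P.-integrable setT (EFin \o (fun w => c * g w)).
  exact: (integrableZl measurableT c gi).
have abi : P.-integrable setT (EFin \o (fun w => a + b * f w)).
  exact: (integrableD measurableT ai bfi).
have -> : a + b * \int[P]_w f w + c * \int[P]_w g w =
    \int[P]_w (a + b * f w + c * g w).
  rewrite RintegralD// RintegralD// !RintegralZl// Rintegral_cst//.
  by rewrite [fine _](_ : _ = 1) ?mulr1// -[1]/(fine 1%E) -(probability_setT P).
apply: le_Rintegral => //.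
exact: (integrableD measurableT abi cgi).
Qed.

Lemma Rintegral_dotp {d} {T : measurableType d} {R : realType}
    (P : probability T R) m (p : 'rV[R]_m) (Y : T -> 'rV[R]_m) :
    (forall j, P.-integrable setT (EFin \o (fun w => Y w 0 j))) ->
  \int[P]_w dotp p (Y w) = dotp p (\row_j \int[P]_w Y w 0 j).
Proof.
move=> Yi.
have pYi j : P.-integrable setT (fun w => (p 0 j * Y w 0 j)%:E).
  exact: (integrableZl measurableT (p 0 j) (Yi j)).
rewrite /Rintegral; under eq_integral do rewrite -sumEFin.
rewrite integral_sum// -sum_fine => [|j _]; last exact: integrable_fin_num.
apply: eq_bigr => j _; rewrite mxE.
exact: (RintegralZl (p 0 j) measurableT (Yi j)).
Qed.

(** * The truncated squared distance *)

Section trunc_sqr_dist.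
Context {R : realType} {m : nat}.
Implicit Types (M : R) (A : set 'rV[R]_m) (x y : 'rV[R]_m).

Definition trunc_sqr_dist M A x : R := Num.min M (dist_to A x) ^+ 2.

Lemma trunc_sqr_dist_lipschitz M A x y : 0 <= M -> A !=set0 ->
  `|trunc_sqr_dist M A x - trunc_sqr_dist M A y| <= 2 * M * edist x y.
Proof.
move=> M0 A0; rewrite /trunc_sqr_dist.
have := dist_to_lipschitz x y A0; rewrite mul1r => rL.
set r := dist_to A x in rL *; set s := dist_to A y in rL *.
have r0 : 0 <= r by exact: dist_to_ge0.
have s0 : 0 <= s by exact: dist_to_ge0.
have minL : `|Num.min M r - Num.min M s| <= `|r - s|.
  by rewrite /Num.min; case: ltP => Mr; case: ltP => Ms;
    rewrite ler_norml; apply/andP; split; have := ler_norm (r - s);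
    have := lerNnormlW (lexx `|r - s|); lra.
rewrite subr_sqr normrM mulrC; apply: ler_pM => //.
- rewrite ger0_norm ?addr_ge0 ?le_min ?M0// mulr_natl mulr2n.
  by rewrite lerD// ge_min lexx.
- exact: le_trans rL.
Qed.

Lemma trunc_sqr_dist_bounds M A x : 0 <= M ->
  0 <= trunc_sqr_dist M A x <= M ^+ 2.
Proof.
move=> M0; rewrite sqr_ge0/= lerXn2r ?nnegrE ?le_min ?M0 ?dist_to_ge0//.
by rewrite ge_min lexx.
Qed.

Lemma trunc_sqr_dist_le M A x a : 0 <= M -> A a ->
  trunc_sqr_dist M A x <= enorm (x - a) ^+ 2.
Proof.
move=> M0 Aa; rewrite lerXn2r ?nnegrE ?le_min ?M0 ?dist_to_ge0 ?enorm_ge0//.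
by rewrite ge_min dist_to_le ?orbT.
Qed.

(** Passing to the infimum over a inside the square: take square roots, except
    when r <= 0 and the bound is trivial. *)
Lemma le_trunc_sqr_dist M A x (r : R) : 0 <= M -> A !=set0 -> r <= M ^+ 2 ->
  (forall a, A a -> r <= enorm (x - a) ^+ 2) -> r <= trunc_sqr_dist M A x.
Proof.
move=> M0 A0 rM rA; have [r0|/ltW r0] := leP r 0.
  by rewrite (le_trans r0)// sqr_ge0.
rewrite -(sqr_sqrtr r0) lerXn2r ?nnegrE ?le_min ?M0 ?dist_to_ge0 ?sqrtr_ge0//.
rewrite -(ger0_norm M0) -sqrtr_sqr ler_wsqrtr//=; apply: le_dist_to => // a Aa.
by rewrite -(ger0_norm (enorm_ge0 _)) -sqrtr_sqr ler_wsqrtr// rA.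
Qed.

End trunc_sqr_dist.

(** The identity
      |b + z|^2 = |b|^2 + |z - t|^2 - |t|^2 + 2 <b + t, z>
    without its negative term. When z is centred the last term has mean zero,
    so this is at once the Pythagorean identity and the fact that the mean
    minimizes the mean square deviation, in a form that is integrated only
    once. *)
Lemma sqr_enormD_le {R : realType} {m : nat} (b z t : 'rV[R]_m) :
  enorm (b + z) ^+ 2 <=
  enorm b ^+ 2 + enorm (z - t) ^+ 2 + dotp (2 *: (b + t)) z.
Proof.
rewrite !sqr_enorm !(dotpDl, dotpDr, dotpNl, dotpNr, dotpZl, dotpZr).
rewrite (dotpC z b) (dotpC t z).
by have := dotp_ge0 t; lra.
Qed.

(** * One summand at a frozen past *)

Section main.
Context {R : realType} {Omega : completeMetricType R}.
Local Notation T := (borelType Omega).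
Context (E : (Omega -> R) -> R) (PP : set (probability T R)).
Hypothesis hPP : represents PP E.

Definition square_approximable {m} (Y : Omega -> 'rV[R]_m) : Prop :=
  forall j, approximable PP 2 (fun w => Y w 0 j).

Lemma approximable_of_lipschitz m (g : 'rV[R]_m -> R) (L : R) Y :
    (forall x y, `|g x - g y| <= L * edist x y) -> square_approximable Y ->
  approximable PP 1 (g \o Y).
Proof.
move=> gL aY; apply: approximable_sub21.
exact: approximable_lipschitz_comp gL aY.
Qed.

Lemma sle_ext_le_shift (X Y : Omega -> R) (c : R) :
    approximable PP 1 X -> approximable PP 1 Y -> (forall w, X w <= Y w + c) ->
  sle_ext PP E X <= sle_ext PP E Y + c.
Proof.
move=> aX aY XY; apply: (sle_ext_le hPP aX) => P PPP.
have iX := approximable_integrable aX PPP.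
have iY := approximable_integrable aY PPP.
have XY1 w : X w <= c + 1 * Y w + 0 * Y w by rewrite mul1r mul0r addr0 addrC.
apply: le_trans (Rintegral_le_affine iX iY iY XY1) _.
rewrite mul1r mul0r addr0 [leRHS]addrC lerD2l.
exact: (Rintegral_le_sle_ext hPP aY PPP).
Qed.

Definition mean_vector (P : probability T R) {m} (Y : Omega -> 'rV[R]_m) :
    'rV[R]_m :=
  \row_j \int[P]_w (Y : T -> 'rV[R]_m) w 0 j.

Lemma approximable_dotp m (Y : Omega -> 'rV[R]_m) p : square_approximable Y ->
  approximable PP 1 (fun w => dotp p (Y w)).
Proof.
exact: (approximable_of_lipschitz (dotp_lipschitz p)).
Qed.

Lemma approximable_sqr_enorm m (Y : Omega -> 'rV[R]_m) t :
    square_approximable Y ->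
  approximable PP 1 (fun w => enorm (Y w - t) ^+ 2).
Proof.
move=> aY; apply: approximable_sqr.
exact: (approximable_lipschitz_comp (enorm_sub_lipschitz t)).
Qed.

Lemma integrable_coord m (Y : Omega -> 'rV[R]_m) P j : square_approximable Y ->
  PP P -> P.-integrable setT (EFin \o (fun w : T => Y w 0 j)).
Proof.
by move=> aY PPP; apply: approximable_integrable PPP; exact: approximable_sub21.
Qed.

Lemma Rintegral_dotp_mean_vector m (Y : Omega -> 'rV[R]_m) P p :
    square_approximable Y -> PP P ->
  \int[P]_w (fun w : T => dotp p (Y w)) w = dotp p (mean_vector P Y).
Proof. by move=> aY PPP; apply: Rintegral_dotp => j; exact: integrable_coord. Qed.

Lemma mean_vector_in_mean_set m (Y : Omega -> 'rV[R]_m) P :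
    square_approximable Y -> PP P ->
  mean_set PP E Y (mean_vector P Y).
Proof.
move=> aY PPP p; rewrite dotpC -(Rintegral_dotp_mean_vector p aY PPP).
exact: (Rintegral_le_sle_ext hPP (approximable_dotp p aY) PPP).
Qed.

Definition min_variance {m} (Y : Omega -> 'rV[R]_m) : R :=
  inf [set sle_ext PP E (fun w => enorm (Y w - t) ^+ 2) | t in mean_set PP E Y].

Lemma min_variance_ge0 m (Y : Omega -> 'rV[R]_m) : square_approximable Y ->
  0 <= min_variance Y.
Proof.
move=> aY; apply: inf_nonneg => _ [t _ <-].
have [P PPP] := representing_nonempty hPP.
apply: le_trans (Rintegral_le_sle_ext hPP (approximable_sqr_enorm t aY) PPP).
by apply: Rintegral_ge0 => w _; exact: sqr_ge0.
Qed.

Lemma approximable_trunc m (Y : Omega -> 'rV[R]_m) M A s c :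
    square_approximable Y -> 0 <= M -> A !=set0 ->
  approximable PP 1 (fun w => trunc_sqr_dist M A (s + c *: Y w)).
Proof.
move=> aY M0 A0.
apply: (@approximable_of_lipschitz _
  (fun y => trunc_sqr_dist M A (s + c *: y)) (2 * M * `|c|)) => // x y.
apply: le_trans (trunc_sqr_dist_lipschitz _ _ M0 A0) _.
rewrite -[leRHS]mulrA ler_wpM2l ?mulr_ge0//.
by rewrite /Defs.edist opprD addrACA subrr add0r -scalerBr enormZ.
Qed.

(** The step of the recursion, with the past frozen at s. Under P the centre
    a + c th, for th the P-mean of Y, is admissible in B; it is compared with an
    arbitrary t of the mean set by means of [sqr_enormD_le] with b = s - a,
    z = c (Y - th) and c (t - th) in the role of t. The result no longer
    involves th, so the infima over a and t may be taken for each P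
    separately. *)
Lemma sle_ext_trunc_sqr_dist_le m (A B : set 'rV[R]_m)
    (Y : Omega -> 'rV[R]_m) s c M :
    square_approximable Y -> 0 <= M -> 0 < c -> A !=set0 ->
    (forall a t, A a -> mean_set PP E Y t -> B (a + c *: t)) ->
  sle_ext PP E (fun w => trunc_sqr_dist M B (s + c *: Y w)) <=
  trunc_sqr_dist M A s + c ^+ 2 * min_variance Y.
Proof.
move=> aY M0 c0 [a0 Aa0] AB.
have [P0 PPP0] := representing_nonempty hPP.
have B0 : B !=set0.
  exists (a0 + c *: mean_vector P0 Y); apply: AB => //.
  exact: mean_vector_in_mean_set.
have aB := approximable_trunc s c aY M0 B0.
apply: (sle_ext_le hPP) => // P PPP; set I := \int[P]_w _.
have iB := approximable_integrable aB PPP.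
have c20 : 0 < c ^+ 2 by rewrite exprn_gt0.
have bound a t : A a -> mean_set PP E Y t ->
    I <= enorm (s - a) ^+ 2 +
      c ^+ 2 * sle_ext PP E (fun w => enorm (Y w - t) ^+ 2).
  move=> Aa Yt; pose th := mean_vector P Y; pose b := s - a.
  have Yth : mean_set PP E Y th by exact: mean_vector_in_mean_set.
  pose p := c *: (2 *: (b + c *: (t - th))).
  pose f (w : T) := enorm (Y w - t) ^+ 2; pose g (w : T) := dotp p (Y w).
  have fi : P.-integrable setT (EFin \o f).
    exact: approximable_integrable (approximable_sqr_enorm t aY) PPP.
  have gi : P.-integrable setT (EFin \o g).
    exact: approximable_integrable (approximable_dotp p aY) PPP.
  have h w : trunc_sqr_dist M B (s + c *: Y w) <=
      (enorm b ^+ 2 - dotp p th) + c ^+ 2 * f w + 1 * g w.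
    apply: le_trans (trunc_sqr_dist_le _ M0 (AB _ _ Aa Yth)) _.
    have -> : s + c *: Y w - (a + c *: th) = b + c *: (Y w - th).
      by rewrite opprD addrACA scalerBr.
    apply: le_trans (sqr_enormD_le _ _ (c *: (t - th))) _.
    rewrite -scalerBr opprB addrA subrK enormZ exprMn real_normK ?num_real//.
    rewrite dotpZr -dotpZl -/p dotpDr dotpNr /f /g; lra.
  apply: le_trans (Rintegral_le_affine iB fi gi h) _.
  rewrite mul1r (Rintegral_dotp_mean_vector p aY PPP) addrAC addrNK lerD2l.
  rewrite ler_pM2l//.
  exact: (Rintegral_le_sle_ext hPP (approximable_sqr_enorm t aY) PPP).
rewrite -lerBlDr; apply: le_trunc_sqr_dist => //; first by exists a0.
  pose g w := trunc_sqr_dist M B (s + c *: Y w).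
  have h w : g w <= M ^+ 2 + 0 * g w + 0 * g w.
    rewrite mul0r !addr0.
    by case/andP: (trunc_sqr_dist_bounds B (s + c *: Y w) M0).
  have := Rintegral_le_affine iB iB iB h; rewrite mul0r !addr0 -/I => IM.
  rewrite lerBlDr -[leLHS]addr0; apply: lerD => //.
  by rewrite mulr_ge0 ?min_variance_ge0// ltW.
move=> a Aa; rewrite lerBlDl -lerBlDr mulrC -ler_pdivrMr//; apply: lb_le_inf.
  exists (sle_ext PP E (fun w => enorm (Y w - mean_vector P Y) ^+ 2)).
  by exists (mean_vector P Y) => //; exact: mean_vector_in_mean_set.
move=> _ [t Yt <-]; rewrite ler_pdivrMr// lerBlDl mulrC; exact: bound.
Qed.

(** * Removal of the truncation *)

(** Under every P the part of Y^2 that the truncation at M discards has small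
    mean: Y^2 is within e in mean of a bounded function u, and wherever Y > M
    with M^2 above the bound of u, Y^2 exceeds M^2 by at most |u - Y^2|. *)
Lemma sle_ext_sqr_le_of_trunc (Y : Omega -> R) (b : R) :
    approximable PP 2 Y -> (forall w, 0 <= Y w) ->
    (forall M, 0 <= M -> approximable PP 1 (fun w => Num.min M (Y w) ^+ 2) /\
      sle_ext PP E (fun w => Num.min M (Y w) ^+ 2) <= b) ->
  sle_ext PP E (fun w => Y w ^+ 2) <= b.
Proof.
move=> aY Y0 hb; have aY2 := approximable_sqr aY.
apply: (sle_ext_le hPP aY2) => P PPP; apply/ler_addgt0Pr => e e0.
have [u uC hu] := aY2.2 _ e0.
have [C uM] : exists C : R, forall w, `|u w| <= C.
  by case: uC => -[C ?]; exists C.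
pose M := `|C| + 1; have M0 : 0 <= M by rewrite addr_ge0.
have CM : C <= M ^+ 2.
  have := ler_norm C; have := normr_ge0 C; rewrite /M; nra.
have [aM hM] := hb M M0.
pose r (w : T) := `|u w - Y w ^+ 2|.
have iu := approximable_integrable (CbLip_approximable PP (ltnSn 0) uC) PPP.
have iY2 := approximable_integrable aY2 PPP.
have ir : P.-integrable setT (EFin \o r).
  exact: (integrable_norm (integrableB measurableT iu iY2)).
have h w : Y w ^+ 2 <= 0 + 1 * Num.min M (Y w) ^+ 2 + 1 * r w.
  rewrite add0r !mul1r /r; have [YM|MY] := leP (Y w) M.
    by rewrite lerDl.
  have := ler_norm (u w); have := uM w; have := ler_norm (- (u w - Y w ^+ 2)).
  by rewrite normrN; lra.
have iM := approximable_integrable aM PPP.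
apply: le_trans (Rintegral_le_affine iY2 iM ir h) _.
rewrite add0r !mul1r lerD//.
  exact: le_trans (Rintegral_le_sle_ext hPP aM PPP) hM.
rewrite -lee_fin; apply: le_trans (hu P PPP); rewrite /Rintegral fineK//.
exact: integrable_fin_num.
Qed.

(** * The recursion along the sequence *)

Lemma sle_ext_cst (r : R) : sle_ext PP E (fun=> r) = r.
Proof.
have ar : approximable PP 1 (fun=> r : R).
  apply: CbLip_approximable => //; split; first by exists `|r|.
  by exists 0 => x y; rewrite subrr normr0 mul0r.
have Er (P : probability T R) : \int[P]_w (fun=> r : R) w = r.
  rewrite Rintegral_cst// [fine _](_ : _ = 1) ?mulr1//.
  by rewrite -[1]/(fine 1%E) -(probability_setT P).
apply/eqP; rewrite eq_le; apply/andP; split.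
  by apply: (sle_ext_le hPP ar) => P _; rewrite Er.
have [P PPP] := representing_nonempty hPP.
by rewrite -{1}(Er P); exact: (Rintegral_le_sle_ext hPP ar PPP).
Qed.

(** This makes the inner expectation of the independence identity a Lipschitz
    function of the past, so that the outer one is a supremum of means. *)
Lemma lipschitz_sle_ext d1 d2 (psi : 'rV[R]_(d1 + d2) -> R) (L : R)
    (Y : Omega -> 'rV[R]_d2) :
    (forall x y, `|psi x - psi y| <= L * edist x y) -> square_approximable Y ->
  forall x y : 'rV[R]_d1,
    `|sle_ext PP E (fun w => psi (row_mx x (Y w))) -
      sle_ext PP E (fun w => psi (row_mx y (Y w)))| <= L * edist x y.
Proof.
move=> psiL aY.
have apsi x : approximable PP 1 (fun w => psi (row_mx x (Y w))).
  apply: (@approximable_of_lipschitz _ (fun y => psi (row_mx x y)) L) => // u v.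
  by rewrite -(edist_row_mxr x).
suff h x y : sle_ext PP E (fun w => psi (row_mx x (Y w))) <=
    sle_ext PP E (fun w => psi (row_mx y (Y w))) + L * edist x y.
  by move=> x y; rewrite ler_distl h lerBlDr edistC h.
apply: sle_ext_le_shift => // w; rewrite -lerBlDl.
by apply: le_trans (ler_norm _) _; rewrite -(edist_row_mxl (Y w)).
Qed.

Section sequence.
Context (d n : nat) (X : 'I_n -> Omega -> 'rV[R]_d) (c : R).
Hypotheses (aX : forall i, square_approximable (X i)) (c0 : 0 < c).

(** The scaling by c is kept inside the partial sums: for c = 1/n and k = n they
    are the average and its set of centres. *)
Definition partial_sum k w : 'rV[R]_d := c *: \sum_(i < n | (i < k)%N) X i w.

Lemma square_approximable_partial_sum k : square_approximable (partial_sum k).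
Proof.
move=> j; pose p : 'rV[R]_n := \row_i (if (i < k)%N then c else 0).
have -> : (fun w => partial_sum k w 0 j) = dotp p \o (fun w => \row_i X i w 0 j).
  apply/funext => w /=; rewrite mxE summxE mulr_sumr big_mkcond.
  by apply: eq_bigr => i _; rewrite !mxE; case: ifP; rewrite ?mul0r.
apply: (approximable_lipschitz_comp (dotp_lipschitz p)) => i.
by under eq_fun do rewrite mxE; exact: aX.
Qed.

Definition partial_mean_set k : set 'rV[R]_d :=
  [set c *: \sum_(i < n | (i < k)%N) t i | t in
    [set t : 'I_n -> 'rV[R]_d | forall i, mean_set PP E (X i) (t i)]].

Lemma partial_mean_set_nonempty k : partial_mean_set k !=set0.
Proof.
have [P PPP] := representing_nonempty hPP.
exists (c *: \sum_(i < n | (i < k)%N) mean_vector P (X i)).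
by exists (fun i => mean_vector P (X i)) => // i; exact: mean_vector_in_mean_set.
Qed.

Lemma sum_ltnS (V : zmodType) (F : 'I_n -> V) (k : 'I_n) :
  \sum_(i < n | (i < k.+1)%N) F i = \sum_(i < n | (i < k)%N) F i + F k.
Proof.
rewrite (bigD1 k)//= addrC; congr (_ + _); apply: eq_bigl => i.
by rewrite ltnS [RHS]ltn_neqAle andbC.
Qed.

Lemma partial_mean_setS (k : 'I_n) a t : partial_mean_set k a ->
  mean_set PP E (X k) t -> partial_mean_set k.+1 (a + c *: t).
Proof.
move=> [s hs <-] ht; exists (fun i => if i == k then t else s i) => [i|].
  by case: eqP => [->|_]; [exact: ht|exact: hs].
rewrite sum_ltnS eqxx -scalerDr; congr (c *: (_ + _)).
by apply: eq_bigr => i ik; rewrite -val_eqE ltn_eqF.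
Qed.

Lemma square_approximable_past (k : 'I_n) : square_approximable (past X k).
Proof.
move=> j; case/mxvec_indexP: j => a b.
have -> : (fun w => past X k w 0 (mxvec_index a b)) =
    (fun w => X (widen_ord (ltnW (ltn_ord k)) a) w 0 b).
  by apply/funext => w; rewrite /past mxvecE mxE.
exact: aX.
Qed.

Definition sum_past (k : nat) (z : 'rV[R]_(k * d)) : 'rV[R]_d :=
  c *: \sum_(j < k) row j (vec_mx z).

Lemma sum_past_past (k : 'I_n) w : sum_past (past X k w) = partial_sum k w.
Proof.
rewrite /sum_past /partial_sum (big_ord_narrow (ltnW (ltn_ord k))).
by congr (c *: _); apply: eq_bigr => j _; rewrite /past mxvecK rowK.
Qed.

Lemma sum_past_linear k : linear (fun z : 'rV[R]_(k * d + d) =>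
  sum_past (lsubmx z) + c *: rsubmx z).
Proof.
move=> a x y; rewrite /sum_past -!scalerDr scalerA mulrC -scalerA -scalerDr.
congr (c *: _); rewrite !linearP/=.
under eq_bigr do rewrite linearP/=.
by rewrite big_split/= -scaler_sumr scalerDr addrACA.
Qed.

Lemma partial_sumS (k : 'I_n) w :
  partial_sum k.+1 w = partial_sum k w + c *: X k w.
Proof. by rewrite /partial_sum sum_ltnS scalerDr. Qed.

Hypothesis hind : independent_seq PP E X.

(** Independence turns the expectation into that of the step at a frozen past,
    evaluated at the past. For k = 0 there is no past, and the frozen step is
    used at s = 0. *)
Lemma partial_sum_step_le M (k : 'I_n) : 0 <= M ->
  sle_ext PP E (fun w =>
    trunc_sqr_dist M (partial_mean_set k.+1) (partial_sum k.+1 w)) <=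
  sle_ext PP E (fun w =>
    trunc_sqr_dist M (partial_mean_set k) (partial_sum k w)) +
  c ^+ 2 * min_variance (X k).
Proof.
move=> M0; set v := c ^+ 2 * _.
pose phi := trunc_sqr_dist M (partial_mean_set k.+1).
have phiL x y : `|phi x - phi y| <= 2 * M * edist x y.
  exact: (trunc_sqr_dist_lipschitz _ _ M0 (partial_mean_set_nonempty k.+1)).
have step s : sle_ext PP E (fun w => phi (s + c *: X k w)) <=
    trunc_sqr_dist M (partial_mean_set k) s + v.
  apply: sle_ext_trunc_sqr_dist_le => //; first exact: partial_mean_set_nonempty.
  by move=> a t; exact: partial_mean_setS.
under [X in sle_ext PP E X <= _]eq_fun do rewrite partial_sumS.
have [k0|k0] := posnP k.
  have S0 w : partial_sum k w = 0.
    by rewrite /partial_sum big1 ?scaler0// => i; rewrite k0.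
  under eq_fun do rewrite S0.
  under [X in _ <= sle_ext PP E X + _]eq_fun do rewrite S0.
  by rewrite sle_ext_cst; exact: step.
pose psi (z : 'rV[R]_(k * d + d)) := phi (sum_past (lsubmx z) + c *: rsubmx z).
have [C C0 fC] := linear_lipschitz (@sum_past_linear k).
have psiL x y : `|psi x - psi y| <= 2 * M * C * edist x y.
  by apply: le_trans (phiL _ _) _; rewrite -[leRHS]mulrA ler_wpM2l ?mulr_ge0.
have psiE x y : psi (row_mx x y) = phi (sum_past x + c *: y).
  by rewrite /psi row_mxKl row_mxKr.
have psi_lip : bounded_lipschitz edist psi.
  split; last by exists (2 * M * C).
  exists (M ^+ 2) => x; have /andP[h0 h1] := trunc_sqr_dist_bounds
    (partial_mean_set k.+1) (sum_past (lsubmx x) + c *: rsubmx x) M0.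
  by rewrite ger0_norm.
have -> : (fun w => trunc_sqr_dist M (partial_mean_set k.+1)
      (partial_sum k w + c *: X k w)) =
    (fun w => psi (row_mx (past X k w) (X k w))).
  by apply/funext => w; rewrite psiE sum_past_past.
rewrite (hind k0 psi_lip).
apply: sle_ext_le_shift.
- apply: (@approximable_of_lipschitz _
    (fun x => sle_ext PP E (fun w' => psi (row_mx x (X k w')))) (2 * M * C)).
    exact: lipschitz_sle_ext.
  exact: square_approximable_past.
- apply: (@approximable_of_lipschitz _
    (trunc_sqr_dist M (partial_mean_set k)) (2 * M)) => [x y|].
    apply: trunc_sqr_dist_lipschitz => //; exact: partial_mean_set_nonempty.
  exact: square_approximable_partial_sum.
move=> w /=; under eq_fun do rewrite psiE.
by rewrite sum_past_past; exact: step.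
Qed.

Lemma partial_sum_bound M k : 0 <= M -> (k <= n)%N ->
  sle_ext PP E (fun w =>
    trunc_sqr_dist M (partial_mean_set k) (partial_sum k w)) <=
  \sum_(i < n | (i < k)%N) c ^+ 2 * min_variance (X i).
Proof.
move=> M0; elim: k => [_|k IH kn].
  under eq_fun do rewrite /partial_sum big1 ?scaler0//.
  rewrite sle_ext_cst big1//.
  have P0 : partial_mean_set 0 0.
    have [_ [t ht _]] := partial_mean_set_nonempty 0.
    by exists t => //; rewrite big1 ?scaler0.
  apply: le_trans (trunc_sqr_dist_le 0 M0 P0) _.
  by rewrite subr0 enorm0 expr0n.
rewrite (sum_ltnS _ (Ordinal kn)).
apply: le_trans (partial_sum_step_le (Ordinal kn) M0) _.
by rewrite lerD2r IH// ltnW.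
Qed.

Lemma sqr_dist_sum_le :
  sle_ext PP E (fun w => dist_to (partial_mean_set n) (partial_sum n w) ^+ 2) <=
  \sum_(i < n) c ^+ 2 * min_variance (X i).
Proof.
have n0 := partial_mean_set_nonempty n.
apply: (sle_ext_sqr_le_of_trunc (Y := fun w => dist_to _ (partial_sum n w))).
- apply: (approximable_lipschitz_comp (g := dist_to _)).
    by move=> x y; exact: dist_to_lipschitz.
  exact: square_approximable_partial_sum.
- by move=> w; exact: dist_to_ge0.
move=> M M0; split.
  apply: (@approximable_of_lipschitz _
    (trunc_sqr_dist M (partial_mean_set n)) (2 * M)) => [x y|].
    exact: trunc_sqr_dist_lipschitz.
  exact: square_approximable_partial_sum.
apply: le_trans (partial_sum_bound M0 (leqnn n)) _.
rewrite le_eqVlt; apply/orP; left; apply/eqP.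
by apply: eq_bigl => i; rewrite ltn_ord.
Qed.

End sequence.

Lemma min_variance_le_max d n (X : 'I_n -> Omega -> 'rV[R]_d) i :
  min_variance (X i) <= max_variance PP E X.
Proof.
apply: ub_le_sup; last by exists i.
exists (\sum_i `|min_variance (X i)|) => _ [k _ <-].
by apply: le_trans (ler_norm _) _; rewrite (bigD1 k)//= lerDl sumr_ge0.
Qed.

End main.

Theorem theorem3p2 (R : realType) (Omega : completeMetricType R)
    (sepOmega : separable Omega)
    (E : (Omega -> R) -> R) (hE : regular_sublinear_expectation E)
    (PP : set (probability (borelType Omega) R)) (hPP : represents PP E)
    (d n : nat) (hd : (1 <= d)%N) (hn : (1 < n)%N)
    (X : 'I_n -> Omega -> 'rV[R]_d)
    (hL2 : forall i, Lp_vec PP 2 (X i))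
    (hind : independent_seq PP E X) :
  sle_ext PP E
    (fun w => dist_to (average_set PP E X) (n%:R^-1 *: \sum_(i < n) X i w) ^+ 2)
  <= max_variance PP E X / n%:R.
Proof.
have PP0 := representing_nonempty hPP.
have aX i : square_approximable PP (X i).
  by move=> j; exact: Lp_approximable (hL2 i j).
have n0 : 0 < n%:R :> R by rewrite ltr0n ltnW.
have c0 : 0 < n%:R^-1 :> R by rewrite invr_gt0.
have all_lt (V : zmodType) (F : 'I_n -> V) :
    \sum_(i < n) F i = \sum_(i < n | (i < n)%N) F i.
  by apply: eq_bigl => i; rewrite ltn_ord.
have -> : (fun w =>
      dist_to (average_set PP E X) (n%:R^-1 *: \sum_(i < n) X i w) ^+ 2) =
    (fun w => dist_to (partial_mean_set E PP X n%:R^-1 n)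
      (partial_sum X n%:R^-1 n w) ^+ 2).
  apply/funext => w; rewrite all_lt; congr (dist_to _ _ ^+ 2).
  by apply: eq_imagel => t _; rewrite all_lt.
apply: le_trans (sqr_dist_sum_le hPP aX c0 hind) _.
apply: (@le_trans _ _ (\sum_(i < n) n%:R^-1 ^+ 2 * max_variance PP E X)).
  by apply: ler_sum => i _; rewrite ler_wpM2l ?sqr_ge0// min_variance_le_max.
rewrite sumr_const card_ord -[leLHS]mulr_natr le_eqVlt.
apply/orP; left; apply/eqP.
by field; rewrite gt_eqF.
Qed.
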